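(* For every $\delta > 0$ there exists $\delta' > 0$ such that for all sufficiently large $n$, every $(n,(3-\delta')n)$-multigraph with multiplicity at most $(1-\delta)n$ contains a rainbow matching of size $n$.
   Context: An $(n,v)$-multigraph is a multigraph whose edges are coloured with a set of $n$ colours (parallel edges allowed, with distinct colours) such that each colour class is a vertex-disjoint union of cliques on at least $2$ vertices which together have at least $v$ vertices. The multiplicity is the maximum number of edges joining a single pair of vertices. A rainbow matching is a matching whose edges have pairwise distinct colours. *)

(* Defs.v *)
From mathcomp Require Import all_boot all_order all_algebra.
From mathcomp Require Import reals.
Set Implicit Arguments. Unset Strict Implicit. Unset Printing Implicit Defensive.
Import Order.TTheory GRing.Theory Num.Theory.
Local Open Scope ring_scope.

(* A multigraph on the finite vertex type V with colours 'I_n is given by, for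
   each colour c, the family P c of cliques forming colour class c. *)
Section MG.
Variables (V : finType) (n : nat).

Definition col_edge (P : 'I_n -> {set {set V}}) (c : 'I_n) (x y : V) : bool :=
  (x != y) && [exists B in P c, (x \in B) && (y \in B)].

Definition nv_multigraph (R : realType) (P : 'I_n -> {set {set V}}) (v : R) : Prop :=
  forall c : 'I_n,
    [/\ trivIset (P c),
        (forall B, B \in P c -> (2 <= #|B|)%N)
      & v <= (#|cover (P c)|)%:R].

Definition mult_pair (P : 'I_n -> {set {set V}}) (x y : V) : nat :=
  #|[set c : 'I_n | col_edge P c x y]|.

Definition multiplicity_le (R : realType) (P : 'I_n -> {set {set V}}) (m : R) : Prop :=
  forall x y : V, (mult_pair P x y)%:R <= m.

Definition rainbow_matching (P : 'I_n -> {set {set V}}) (M : {set 'I_n * (V * V)}) : Prop :=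
  (forall e, e \in M -> col_edge P e.1 e.2.1 e.2.2) /\
  (forall e f, e \in M -> f \in M -> e != f ->
     (e.1 != f.1) /\
     [disjoint [set e.2.1; e.2.2] & [set f.2.1; f.2.2]]).
End MG.

(* Main.v *)
(* Suppose that many colours are missing from a maximum rainbow matching.  When a
   missing colour c joins an end of a matching edge of colour e to an unmatched
   vertex u, switching frees the other end and makes e missing instead of c.  No
   missing colour has an edge between two vertices that can be freed by
   compatible switches.  As every colour covers almost 3n vertices, this forces
   almost every matching edge xy to lie in a triangle xyu, with a fixed unmatched
   apex u, of most missing colours.  The colours of these edges can then be made
   missing too, and it follows that almost all of them contain xy, for almost
   every matching edge xy, which contradicts the multiplicity bound.  Hence all
   but a bounded number of colours can be matched.  The leftover colours are
   matched greedily inside a small random vertex set, reserved in advance, in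
   which all but boundedly many colours still have many edges by Chebyshev's
   inequality; the exceptional colours are matched greedily at the start. *)
Require Import Defs.
From mathcomp Require Import all_boot all_order all_algebra zify lra.
From mathcomp Require Import boolp reals.
Set Implicit Arguments. Unset Strict Implicit. Unset Printing Implicit Defensive.

(** * Unions of small cliques *)

Lemma card_bigcup_leq (I T : finType) (A : {set I}) (F : I -> {set T}) :
  #|\bigcup_(i in A) F i| <= \sum_(i in A) #|F i|.
Proof.
elim/big_rec2: _ => [|i m B _ h]; first by rewrite cards0.
by apply: leq_trans (leq_card_setU _ _) _; rewrite leq_add2l.
Qed.

Section Cliques.
Variable V : finType.
Implicit Types (E : rel V) (Z : {set V}).

Definition covered E : {set V} := [set x | [exists y, E x y]].

(** Transitivity off the diagonal together with degree at most 2 means that every component is a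
    vertex, an edge or a triangle. *)
Definition small_cliques E : Prop :=
  [/\ symmetric E, irreflexive E,
      (forall x y z, E x y -> E y z -> x != z -> E x z)
    & (forall x, #|[set y | E x y]| <= 2)].

Definition outside Z E : rel V := [rel x y | [&& E x y, x \notin Z & y \notin Z]].

Lemma coveredP E x : reflect (exists y, E x y) (x \in covered E).
Proof. by rewrite inE; exact: existsP. Qed.

Lemma small_cliques_outside Z E : small_cliques E -> small_cliques (outside Z E).
Proof.
case=> sE iE tE dE; split.
- by move=> x y; rewrite /outside /= sE [(x \notin Z) && _]andbC.
- by move=> x; rewrite /outside /= iE.
- move=> x y z /and3P[xy xZ yZ] /and3P[yz _ zZ] xz; apply/and3P; split=> //.
  exact: tE xy yz xz.
- move=> x; apply: leq_trans (dE x); apply: subset_leq_card; apply/subsetP=> y.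
  by rewrite !inE => /and3P[].
Qed.

(** A covered vertex is lost only if it lies in [Z] or is a neighbour of a covered vertex of [Z],
    and each of these has at most two neighbours. *)
Lemma covered_outside Z E : small_cliques E ->
  #|covered E| <= #|covered (outside Z E)| + 3 * #|Z :&: covered E|.
Proof.
case=> sE iE tE dE.
set A := Z :&: covered E.
have sub : covered E \subset
    covered (outside Z E) :|: (A :|: \bigcup_(z in A) [set y | E z y]).
  apply/subsetP=> x xC; rewrite !in_setU in_setI xC andbT.
  case: (boolP (x \in Z)) => xZ; first by rewrite orbT.
  have /coveredP[y xy] := xC.
  case: (boolP (y \in Z)) => yZ; last first.
    by rewrite (introT (coveredP _ _)) //; exists y; rewrite /outside /= xy xZ.
  rewrite orbC; apply/orP; left; apply/bigcupP; exists y; last by rewrite inE sE.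
  by rewrite in_setI yZ; apply/coveredP; exists x; rewrite sE.
apply: leq_trans (subset_leq_card sub) _.
apply: leq_trans (leq_card_setU _ _) _; rewrite leq_add2l.
apply: leq_trans (leq_card_setU _ _) _; rewrite mulSn leq_add2l.
apply: leq_trans (card_bigcup_leq _ _) _.
by rewrite mulnC -sum_nat_const; apply: leq_sum.
Qed.

Lemma edge_outside Z E : small_cliques E -> 3 * #|Z| < #|covered E| ->
  exists x y, [&& E x y, x \notin Z & y \notin Z].
Proof.
move=> hE hZ.
have h := covered_outside Z hE.
have h2 : #|Z :&: covered E| <= #|Z| by apply/subset_leq_card/subsetIl.
have : 0 < #|covered (outside Z E)| by lia.
by case/card_gt0P=> x /coveredP[y xy]; exists x, y.
Qed.

(** Greedy choice: each chosen edge blocks two vertices, and each blocked vertex costs at most three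
    covered ones. *)
Lemma disjoint_edges E r : small_cliques E -> 6 * r <= #|covered E| ->
  exists F : {set {set V}}, [/\ trivIset F, #|F| = r &
    forall B, B \in F -> exists x y, E x y /\ B = [set x; y]].
Proof.
move=> hE; have [_ iE _ _] := hE.
elim: r => [|r IH] hr.
  exists set0; split; [|by rewrite cards0|by move=> B; rewrite inE].
  by apply/trivIsetP=> A B; rewrite inE.
have [F [tF cF eF]] : _ := IH ltac:(lia).
have cov2 : #|cover F| <= 2 * r.
  rewrite -cF mulnC -sum_nat_const; apply: leq_trans (leq_card_cover _) _.
  apply: leq_sum => B /eF[x [y [_ ->]]]; rewrite cards2; by case: (_ != _).
have [x [y /and3P[xy xF yF]]] : _ := @edge_outside (cover F) E hE ltac:(lia).
have nF : [set x; y] \notin F.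
  apply: contra xF => h; apply/bigcupP; exists [set x; y] => //.
  by rewrite !inE eqxx.
exists ([set x; y] |: F); split.
- have F0 : set0 \notin F.
    by apply/negP=> /eF[z [t [_ /setP/(_ z)]]]; rewrite !inE eqxx.
  have dF B : B \in F -> [disjoint [set x; y] & B].
    move=> BF; rewrite -setI_eq0; apply/eqP/setP=> z; rewrite !inE.
    apply/negP=> /andP[/orP[] /eqP-> zB].
      by move/negP: xF; apply; apply/bigcupP; exists B.
    by move/negP: yF; apply; apply/bigcupP; exists B.
  by case: (trivIsetU1 dF tF F0).
- by rewrite cardsU1 nF cF.
- move=> B /setU1P[->|/eF//]; by exists x, y.
Qed.

End Cliques.

(** * Splitting cliques into edges and triangles *)

Section Splitting.
Variables (V : finType) (P : {set {set V}}).

Let pos (x : V) := index x (enum (pblock P x)).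
Let grp (x : V) := minn (pos x %/ 2) (#|pblock P x| %/ 2).-1.

(* Each block is cut into consecutive pairs along its enumeration; a last odd
   element joins the last pair. *)
Definition split_edge : rel V := [rel x y |
  [&& x != y, x \in cover P, y \in cover P,
      pblock P x == pblock P y & grp x == grp y]].

Hypothesis tP : trivIset P.
Hypothesis P2 : forall B, B \in P -> 2 <= #|B|.

Lemma split_edge_small : small_cliques split_edge.
Proof.
split.
- by move=> x y; rewrite /split_edge /= eq_sym (eq_sym (pblock P x)) (eq_sym (grp x)); case: (x \in _); case: (y \in _).
- by move=> x; rewrite /split_edge /= eqxx.
- move=> x y z /and5P[_ xC _ /eqP pxy /eqP gxy] /and5P[_ _ zC /eqP pyz /eqP gyz] xz.
  by rewrite /split_edge /= xz xC zC pxy pyz gxy gyz !eqxx.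
move=> x.
case: (boolP (x \in cover P)) => xC; last first.
  rewrite (_ : [set y | _] = set0) ?cards0 //; apply/setP=> y.
  rewrite [RHS]inE in_set; apply/negbTE; apply: contra xC => /and5P[//].
set A := [set y | _].
have xA : x \notin A by rewrite in_set /split_edge /= eqxx.
suff: #|x |: A| <= 3 by rewrite cardsU1 xA; lia.
pose s := enum (pblock P x).
have inB y : y \in x |: A -> pblock P y = pblock P x /\ y \in pblock P x /\ grp y = grp x.
  rewrite in_setU1 in_set => /predU1P[->|/and5P[_ _ yC /eqP pxy /eqP gxy]].
    by rewrite mem_pblock.
  by rewrite pxy mem_pblock.
rewrite cardE -(size_map (fun y => index y s)).
(* Group [g] occupies positions [2 * g] and [2 * g + 1]; the last group may also contain
   [2 * g + 2]. *)
apply: (@uniq_leq_size _ _ [:: 2 * grp x; (2 * grp x).+1; (2 * grp x).+2]).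
  rewrite map_inj_in_uniq ?enum_uniq // => y z.
  rewrite !mem_enum => /inB[_ [yB _]] /inB[_ [zB _]] eyz.
  have ys : y \in s by rewrite mem_enum.
  have zs : z \in s by rewrite mem_enum.
  by rewrite -(nth_index x ys) eyz nth_index.
move=> i /mapP[y]; rewrite mem_enum => /inB[py [yB gy]] ->.
have : index y s < #|pblock P x| by rewrite cardE index_mem mem_enum.
have cB : 2 <= #|pblock P x| by apply: P2; apply: pblock_mem.
rewrite -gy /grp /pos py -/s !inE; lia.
Qed.

Lemma covered_split_edge : covered split_edge = cover P.
Proof.
apply/setP=> x; apply/coveredP/idP => [[y /and3P[]]//|xC].
pose s := enum (pblock P x).
have cB : 2 <= #|pblock P x| by apply: P2; apply: pblock_mem.
have xs : x \in s by rewrite mem_enum mem_pblock.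
have ix : index x s < #|pblock P x| by rewrite cardE index_mem.
have gx : grp x = minn (index x s %/ 2) (#|pblock P x| %/ 2).-1 by [].
(* The partner of [x] is the first member of its group, or the second one if [x] is the first. *)
pose j := if index x s == 2 * grp x then (2 * grp x).+1 else 2 * grp x.
have hj : j < size s.
  by rewrite -cardE /j gx; case: ifP; lia.
pose y := nth x s j.
have ys : y \in s by apply: mem_nth.
have iy : index y s = j by rewrite index_uniq ?enum_uniq.
have yB : y \in pblock P x by move: ys; rewrite mem_enum.
have py : pblock P y = pblock P x by apply: same_pblock.
exists y; apply/and5P; split=> //.
- apply/eqP=> exy; move: iy; rewrite -exy /j; case: ifP => /eqP; lia.
- by rewrite -mem_pblock py.
- by rewrite py.
- rewrite {2}/grp /pos py -/s iy gx; apply/eqP.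
  by rewrite /j gx; case: ifP; lia.
Qed.

Lemma split_edge_block x y : split_edge x y ->
  [&& x != y & [exists B in P, (x \in B) && (y \in B)]].
Proof.
case/and5P=> xy xC yC /eqP pxy _; rewrite xy /=.
apply/existsP; exists (pblock P x); rewrite pblock_mem // mem_pblock xC.
by rewrite pxy mem_pblock.
Qed.

End Splitting.

(** * Switching in a maximum rainbow matching *)

Section Matchings.
Variables (C V : finType) (E : C -> rel V).
Implicit Types (D S : {set C}) (vt : C -> bool -> V).

(** Indexing the edges by their colours makes the matching rainbow by construction. The two ends of
    an edge are indexed by [bool]; values of [vt] off [S] carry no information. *)
Definition rmatch S vt : Prop :=
  (forall c, c \in S -> E c (vt c false) (vt c true)) /\
  (forall c c' i j, c \in S -> c' \in S -> c != c' -> vt c i != vt c' j).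

Definition matched S vt : {set V} := \bigcup_(c in S) [set vt c false; vt c true].

Lemma matchedP S vt v :
  reflect (exists2 c, c \in S & exists i, v = vt c i) (v \in matched S vt).
Proof.
apply: (iffP bigcupP) => [[c cS]|[c cS [i ->]]].
  by rewrite !inE => /orP[] /eqP->; exists c => //; [exists false | exists true].
by exists c => //; rewrite !inE; case: i; rewrite eqxx ?orbT.
Qed.

Lemma mem_matched S vt c i : c \in S -> vt c i \in matched S vt.
Proof. by move=> cS; apply/matchedP; exists c => //; exists i. Qed.

Lemma card_matched S vt : #|matched S vt| <= 2 * #|S|.
Proof.
apply: leq_trans (card_bigcup_leq _ _) _.
rewrite mulnC -sum_nat_const; apply: leq_sum => c _.
by rewrite cards2; case: (_ != _).
Qed.

Lemma rmatch_sub S S' vt : S' \subset S -> rmatch S vt -> rmatch S' vt.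
Proof.
move=> /subsetP sS [e1 e2]; split=> [c /sS|c c' i j /sS cS /sS c'S]; first exact: e1.
exact: e2.
Qed.

Lemma matched_sub S S' vt : S' \subset S -> matched S' vt \subset matched S vt.
Proof.
move=> /subsetP sS; apply/subsetP=> v /matchedP[c cS [i ->]].
exact/mem_matched/sS.
Qed.

Lemma rmatch_add S vt c x y : rmatch S vt -> c \notin S -> E c x y ->
    x \notin matched S vt -> y \notin matched S vt ->
  let vt' k := if k == c then fun j : bool => if j then y else x else vt k in
  rmatch (c |: S) vt'.
Proof.
move=> [e1 e2] cS xy xF yF vt'.
have vtS k : k \in S -> vt' k = vt k.
  by move=> kS; rewrite /vt'; case: eqP => // kc; rewrite -kc kS in cS.
have fr k i j : k \in S -> (if i then y else x) != vt k j.
  by move=> kS; case: i; apply/eqP=> h; [move: yF|move: xF]; rewrite h mem_matched.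
have vtc i : vt' c i = if i then y else x by rewrite /vt' eqxx.
split=> [k /setU1P[->|kS]|k k' i j /setU1P[->|kS] /setU1P[->|k'S] kk'].
- by rewrite !vtc.
- by rewrite !vtS // e1.
- by rewrite eqxx in kk'.
- by rewrite vtc vtS // fr.
- by rewrite vtc vtS // eq_sym fr.
- by rewrite !vtS // e2.
Qed.

Hypothesis iE : forall c, irreflexive (E c).

Definition maxmatch D S vt : Prop :=
  [/\ S \subset D, rmatch S vt
    & forall S' vt', S' \subset D -> rmatch S' vt' -> #|S'| <= #|S|].

Lemma maxmatch_no_edge D S vt d x y : maxmatch D S vt -> d \in D -> d \notin S ->
  x \notin matched S vt -> y \notin matched S vt -> ~~ E d x y.
Proof.
case=> SD mS mx dD dS xF yF; apply/negP=> xy.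
have /mx := rmatch_add mS dS xy xF yF.
by rewrite subUset sub1set dD SD cardsU1 dS ltnn => /(_ isT).
Qed.

(** The edge of colour [e] is replaced by the edge from [vt e i] to [u] in colour [c]. The size is
    unchanged, so the result is again maximum; the list of what survives is what allows switches to
    be iterated. *)
Lemma maxmatch_switch D S vt c e i u : maxmatch D S vt ->
    c \in D -> c \notin S -> e \in S -> u \notin matched S vt -> E c (vt e i) u ->
  exists S' vt', [/\ maxmatch D S' vt',
    (e \notin S') /\ (forall d, d \notin S -> d != c -> d \notin S'),
    (forall k, k \in S -> k != e -> k \in S' /\ vt' k = vt k),
    (forall v, v \notin matched S vt -> v != u -> v \notin matched S' vt')
    & vt e (~~ i) \notin matched S' vt'].
Proof.
case=> SD mS mx cD cS eS uF xu.
have [e1 e2] := mS.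
have ce : c != e by apply/eqP=> h; rewrite h eS in cS.
have sub : S :\ e \subset S by rewrite subD1set.
have cS1 : c \notin S :\ e by rewrite in_setD1 negb_and cS orbT.
have xF j : vt e j \notin matched (S :\ e) vt.
  apply/matchedP=> -[k /setD1P[ke kS] [j' h]].
  by move: (e2 _ _ j' j kS eS ke); rewrite h eqxx.
have uF1 : u \notin matched (S :\ e) vt.
  by apply: contra uF; apply/subsetP/matched_sub.
have mS' := rmatch_add (rmatch_sub sub mS) cS1 xu (xF i) uF1.
set vt' := (fun k => _) in mS'.
have vtS k : k \in S -> vt' k = vt k.
  by move=> kS; rewrite /vt'; case: eqP => // kc; rewrite -kc kS in cS.
have xy : vt e (~~ i) != vt e i.
  have h : vt e false != vt e true.
    by apply/eqP=> h; move: (e1 _ eS); rewrite h iE.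
  by case: (i); rewrite // eq_sym.
have vt'c j : vt' c j = if j then u else vt e i by rewrite /vt' eqxx.
have vtN v : v \notin matched (S :\ e) vt -> v != u -> v != vt e i ->
    v \notin matched (c |: S :\ e) vt'.
  move=> vF vu vx; apply/matchedP=> -[k /setU1P[->|kS'] [j]].
    by rewrite vt'c; case: j => h; [rewrite h eqxx in vu|rewrite h eqxx in vx].
  by rewrite vtS ?(subsetP sub) // => h; rewrite h mem_matched in vF.
have eSF v : v \notin matched S vt -> v != vt e i.
  by apply: contra => /eqP->; exact: mem_matched.
exists (c |: S :\ e), vt'; split.
- split=> [|//|S1 vt1 S1D m1].
    by rewrite subUset sub1set cD (subset_trans sub SD).
  apply: leq_trans (mx _ _ S1D m1) _.
  by rewrite cardsU1 cS1 (cardsD1 e S) eS.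
- split=> [|d dS dc]; rewrite !inE; first by rewrite eq_sym (negbTE ce) eqxx.
  by rewrite (negbTE dc) (negbTE dS) andbF.
- by move=> k kS ke; rewrite !inE ke kS orbT vtS.
- move=> v vF vu; apply: vtN => //; last exact: eSF.
  by apply: contra vF; apply/subsetP/matched_sub.
- by apply: vtN => //; apply/eqP=> h; rewrite -h mem_matched in uF.
Qed.

End Matchings.

Lemma pick_avoid2 (T : finType) (A : {set T}) a b :
  2 < #|A| -> exists c, [/\ c \in A, c != a & c != b].
Proof.
move=> hA; have : 0 < #|A :\ a :\ b|.
  by move: hA; rewrite (cardsD1 a) (cardsD1 b (A :\ a)); case: (a \in A); case: (b \in _); lia.
by case/card_gt0P=> c; rewrite !inE => /and3P[cb ca cA]; exists c.
Qed.

(** * Ends that can be freed, and their apexes *)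

Section Switching.
Variables (C V : finType) (E : C -> rel V).
Hypothesis hE : forall c, small_cliques (E c).
Variables (D S : {set C}) (vt : C -> bool -> V).
Hypothesis hmax : maxmatch E D S vt.

Let iE c : irreflexive (E c). Proof. by case: (hE c). Qed.
Let sE c : symmetric (E c). Proof. by case: (hE c). Qed.
Let tE c x y z : E c x y -> E c y z -> x != z -> E c x z.
Proof. by case: (hE c) => _ _ h _; exact: h. Qed.

Notation C0 := (D :\: S).
Notation M := (matched S vt).

Implicit Types (p y z : C * bool).
Definition vtx p : V := vt p.1 p.2.
Definition mate p : C * bool := (p.1, ~~ p.2).

Lemma mateK : involutive mate. Proof. by case=> c i; rewrite /mate /= negbK. Qed.

Lemma vtx_mem p : p.1 \in S -> vtx p \in M. Proof. exact: mem_matched. Qed.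

Lemma vtx_inj p q : p.1 \in S -> q.1 \in S -> vtx p = vtx q -> p = q.
Proof.
case: p q => [c i] [c' i'] /= cS cS'; rewrite /vtx /= => h.
case: hmax => _ [e1 e2] _.
have cc : c = c' by apply/eqP/negPn/negP=> /(e2 _ _ i i' cS cS'); rewrite h eqxx.
rewrite -cc in h *; congr pair; move: (e1 _ cS).
by case: i i' h => -[] //= ->; rewrite iE.
Qed.

Lemma free_no_edge d u v : d \in C0 -> u \notin M -> v \notin M -> ~~ E d u v.
Proof. by case/setDP=> dD dS uF vF; exact: (maxmatch_no_edge hmax dD dS uF vF). Qed.

(** Two free neighbours of [x] would be joined to each other in the missing colour [d]. *)
Lemma free_nbr_uniq d x u v : d \in C0 -> u \notin M -> v \notin M ->
  E d x u -> E d x v -> u = v.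
Proof.
move=> d0 uF vF xu xv; apply/eqP/negPn/negP=> uv.
have ux : E d u x by rewrite sE.
by have := tE ux xv uv; rewrite (negbTE (free_no_edge d0 uF vF)).
Qed.

Lemma switch_free_no_edge c y u d w : c \in C0 -> y.1 \in S -> u \notin M ->
  E c (vtx (mate y)) u -> d \in C0 -> d != c -> w \notin M -> w != u ->
  ~~ E d (vtx y) w.
Proof.
move=> /setDP[cD cS] yS uF xu /setDP[dD dS] dc wF wu.
have [S' [vt' [m' [_ c']] _ fr yF]] := maxmatch_switch iE hmax cD cS yS uF xu.
rewrite /mate /= negbK in yF.
exact: (maxmatch_no_edge m' dD (c' _ dS dc) yF (fr _ wF wu)).
Qed.

(** Two switches with distinct colours, matching edges and free vertices do not interfere. Together
    they free both ends while [d] stays missing. *)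
Lemma switch2_no_edge c y u c' z u' d :
  c \in C0 -> y.1 \in S -> u \notin M -> E c (vtx (mate y)) u ->
  c' \in C0 -> z.1 \in S -> u' \notin M -> E c' (vtx (mate z)) u' ->
  d \in C0 -> c' != c -> d != c -> d != c' -> u' != u -> z.1 != y.1 ->
  ~~ E d (vtx y) (vtx z).
Proof.
move=> /setDP[cD cS] yS uF xu /setDP[c'D c'S] zS uF' xu' /setDP[dD dS] c'c dc dc' u'u zy.
have [S' [vt' [m' [_ h2] h3 h4 h5]]] := maxmatch_switch iE hmax cD cS yS uF xu.
have [zS' vz] := h3 _ zS zy.
have xu1 : E c' (vt' z.1 (~~ z.2)) u' by rewrite vz.
have [S2 [vt2 [m2 [_ k2] k3 k4 k5]]] :=
  maxmatch_switch iE m' c'D (h2 _ c'S c'c) zS' (h4 _ uF' u'u) xu1.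
rewrite negbK in h5.
rewrite negbK vz in k5.
apply: (maxmatch_no_edge m2 dD (k2 _ (h2 _ dS dc) dc') _ k5).
apply: k4 => //; apply/eqP=> h; move: uF'; rewrite -h.
by rewrite vtx_mem.
Qed.

Definition reach c p := [exists u, (u \notin M) && E c (vtx p) u].

(** These are the colours that can free [y]: the switch attaches the opposite end to an unmatched
    vertex, hence [mate]. *)
Definition opts y := [set c in C0 | reach c (mate y)].

(* The thresholds 6 and 3 leave a choice of colour avoiding two given ones,
   and make the dominating vertex unique. *)
Definition freeable y := (y.1 \in S) && (6 <= #|opts y|).

Definition dominates y u :=
  (u \notin M) && (#|[set c in opts y | ~~ E c (vtx (mate y)) u]| < 3).

Definition apex y : option V := [pick u | dominates y u].

Lemma optsP y c : reflect (c \in C0 /\ exists u, u \notin M /\ E c (vtx (mate y)) u)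
  (c \in opts y).
Proof.
rewrite /opts [X in reflect _ X]in_set; apply: (iffP andP) => -[h1 h2]; split=> //.
  by case/existsP: h2 => u /andP[]; exists u.
by case: h2 => u [h h2]; apply/existsP; exists u; rewrite h.
Qed.

Lemma card_optsI y u : freeable y -> dominates y u ->
  3 < #|[set c in opts y | E c (vtx (mate y)) u]|.
Proof.
case/andP=> _ h6 /andP[_]; rewrite -(cardsID [set c | E c (vtx (mate y)) u]) in h6.
have -> : [set c in opts y | E c (vtx (mate y)) u] = opts y :&: [set c | E c (vtx (mate y)) u].
  by apply/setP=> c; rewrite !in_set.
have -> : [set c in opts y | ~~ E c (vtx (mate y)) u] = opts y :\: [set c | E c (vtx (mate y)) u].
  by apply/setP=> c; rewrite !in_set andbC.
lia.
Qed.

(** At least four options lead to [u], and by [free_nbr_uniq] none of them leads to another free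
    vertex [v], which tolerates only two exceptions. *)
Lemma dominates_uniq y u v : freeable y -> dominates y u -> dominates y v -> u = v.
Proof.
move=> fy hu /andP[vF hv]; have /andP[uF _] := hu.
have : [set c in opts y | E c (vtx (mate y)) u] \subset
       [set c in opts y | ~~ E c (vtx (mate y)) v] -> u = v.
  by move/subset_leq_card; have := card_optsI fy hu; lia.
case: (eqVneq u v) => // uv; apply; apply/subsetP=> c.
rewrite in_set => /andP[copt xu]; rewrite in_set copt /=.
have /optsP[c0 _] := copt.
by apply/negP=> xv; rewrite (free_nbr_uniq c0 uF vF xu xv) eqxx in uv.
Qed.

Lemma apex_dominates y u : freeable y -> (apex y = Some u) <-> dominates y u.
Proof.
move=> fy; rewrite /apex; case: pickP => [v hv|h]; split=> //.
- by case=> <-.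
- by move=> hu; congr Some; exact: dominates_uniq hv hu.
- by rewrite h.
Qed.

(** Were [w] not dominating, some option other than [d] would free [y] through a vertex different
    from [w], and the edge to [w] would extend the matching. *)
Lemma edge_freeable_free d y w : d \in C0 -> freeable y -> w \notin M ->
  E d (vtx y) w -> apex y = Some w.
Proof.
move=> d0 fy wF yw; have /andP[yS _] := fy.
apply/(apex_dominates _ fy); rewrite /dominates wF ltnNge; apply/negP=> h3.
have [c [+ cd _]] := pick_avoid2 d d h3.
rewrite in_set => /andP[/optsP[c0 [u [uF xu]]] xw].
have wu : w != u by apply: contra xw => /eqP->.
have dc : d != c by rewrite eq_sym.
by move: (switch_free_no_edge c0 yS uF xu d0 dc wF wu); rewrite yw.
Qed.

(** Unless both apexes exist and agree, the two ends can be freed by compatible switches that leave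
    [d] missing. *)
Lemma edge_freeable2 d y z : d \in C0 -> freeable y -> freeable z ->
  z.1 != y.1 -> E d (vtx y) (vtx z) -> exists2 u, apex y = Some u & apex z = Some u.
Proof.
move=> d0 fy fz zy yz; have /andP[yS y6] := fy; have /andP[zS z6] := fz.
have yz1 : y.1 != z.1 by rewrite eq_sym.
have zyE : E d (vtx z) (vtx y) by rewrite sE.
(* The switch for [q] is fixed first, through some [u']. As [u'] does not dominate [p], three
   options of [p] avoid it, and one of them differs from both [d] and [c']. *)
have flex p q : freeable p -> freeable q -> q.1 != p.1 -> E d (vtx p) (vtx q) ->
    apex p = None -> False.
  move=> fp fq qp pq ap; have /andP[pS _] := fp; have /andP[qS q6] := fq.
  have q3 : 2 < #|opts q| by exact: leq_trans q6.
  have [c' [/optsP[c'0 [u' [uF' xu']]] c'd _]] := pick_avoid2 d d q3.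
  have p3 : 2 < #|[set c in opts p | ~~ E c (vtx (mate p)) u']|.
    rewrite ltnNge; apply/negP=> h3.
    have /(apex_dominates _ fp) : dominates p u' by rewrite /dominates uF' ltnS.
    by rewrite ap.
  have [c [+ cd cc']] := pick_avoid2 d c' p3.
  rewrite in_set => /andP[/optsP[c0 [u [uF xu]]] xu2].
  have u'u : u' != u by apply: contra xu2 => /eqP->.
  move: (switch2_no_edge c0 pS uF xu c'0 qS uF' xu' d0); rewrite pq.
  by rewrite eq_sym cc' eq_sym cd eq_sym c'd; move=> /(_ isT isT isT u'u qp).
case ay : (apex y) => [u|]; last by case: (flex y z).
case az : (apex z) => [v|]; last by case: (flex z y).
exists u => //; congr Some; apply/eqP; apply/negPn/negP=> vu.
have /(apex_dominates _ fy) du := ay; have /(apex_dominates _ fz) dv := az.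
have /andP[uF _] := du; have /andP[vF _] := dv.
have [c [+ cd _]] := pick_avoid2 d d (ltnW (card_optsI fy du)).
have [c' [+ c'd c'c]] := pick_avoid2 d c (ltnW (card_optsI fz dv)).
rewrite in_set => /andP[/optsP[c'0 _] xv]; rewrite in_set => /andP[/optsP[c0 _] xu].
move: (switch2_no_edge c0 yS uF xu c'0 zS vF xv d0); rewrite yz.
by rewrite c'c eq_sym cd eq_sym c'd => /(_ isT isT isT vu zy).
Qed.

End Switching.

(** * Counting around a maximum rainbow matching *)

Lemma double_count (I J : finType) (A : {set I}) (B : {set J}) (r : I -> J -> bool) :
  \sum_(i in A) #|[set j in B | r i j]| = \sum_(j in B) #|[set i in A | r i j]|.
Proof.
rewrite (eq_bigr (fun i => \sum_(j in B) r i j)) => [|i _].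
  rewrite exchange_big; apply: eq_bigr => j _ /=.
  by rewrite -sum1dep_card big_mkcondr.
by rewrite -sum1dep_card big_mkcondr.
Qed.

(* A fibre with s >= 2 elements satisfies s <= 2 (s - 1). *)
Lemma card_collisions (I J : finType) (A : {set I}) (g : I -> J) :
  #|[set a in A | [exists b in A, (b != a) && (g b == g a)]]| + 2 * #|g @: A| <= 2 * #|A|.
Proof.
set A2 := [set a in A | _].
have A2s : A2 \subset A by apply/subsetP=> a; rewrite inE => /andP[].
have cA : #|A2| + #|A :\: A2| = #|A|.
  by rewrite -(cardsID A2 A) (setIidPr A2s).
have gA : #|g @: A| <= #|g @: A2| + #|g @: (A :\: A2)|.
  by rewrite -{1}(setID A A2) (setIidPr A2s) imsetU leq_card_setU.
have g1 := leq_imset_card g (A :\: A2).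
suff : 2 * #|g @: A2| <= #|A2| by lia.
rewrite mulnC -sum_nat_const.
have -> : #|A2| = \sum_(u in g @: A2) #|[set a in A2 | g a == u]|.
  rewrite double_count -sum1_card; apply: eq_bigr => a aA.
  rewrite (_ : [set i in _ | _] = [set g a]) ?cards1 //.
  apply/setP=> u; rewrite in_set in_set1 eq_sym.
  by case: eqP => [->|]; rewrite ?andbF // imset_f.
apply: leq_sum => u /imsetP[a aA2 ->].
have := aA2; rewrite inE => /andP[aA /existsP[b /and3P[bA ba /eqP gb]]].
have bA2 : b \in A2.
  by rewrite inE bA; apply/existsP; exists a; rewrite aA eq_sym ba gb eqxx.
have <- : #|[set a; b]| = 2 by rewrite cards2 eq_sym ba.
apply: subset_leq_card; apply/subsetP=> x; rewrite in_set2 in_set => /orP[] /eqP->.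
  by rewrite aA2 eqxx.
by rewrite bA2 gb eqxx.
Qed.

Section MaximumMatching.
Variables (C V : finType) (E : C -> rel V).
Hypothesis hE : forall c, small_cliques (E c).
Variables (D S : {set C}) (vt : C -> bool -> V).
Hypothesis hmax : maxmatch E D S vt.

Let iE c : irreflexive (E c). Proof. by case: (hE c). Qed.
Let sE c : symmetric (E c). Proof. by case: (hE c). Qed.
Let tE c x y z : E c x y -> E c y z -> x != z -> E c x z.
Proof. by case: (hE c) => _ _ h _; exact: h. Qed.
Let dE c x : #|[set y | E c x y]| <= 2. Proof. by case: (hE c). Qed.
Let SD : S \subset D. Proof. by case: hmax. Qed.

Notation C0 := (D :\: S).
Notation M := (matched S vt).
Notation vx := (vtx vt).
Notation freeable := (freeable E D S vt).
Notation apex := (apex E D S vt).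
Notation opts := (opts E D S vt).
Notation reach := (reach E S vt).
Let free_nbr_uniq := free_nbr_uniq hE hmax.
Let edge_freeable_free := edge_freeable_free hE hmax.
Let edge_freeable2 := edge_freeable2 hE hmax.
Let apex_dominates := apex_dominates hE hmax.

Implicit Types p q : C * bool.

Definition ends : {set C * bool} := [set p | p.1 \in S].

Lemma mem_ends p : (p \in ends) = (p.1 \in S). Proof. by rewrite in_set. Qed.

Lemma card_ends : #|ends| = 2 * #|S|.
Proof.
have -> : ends = setX S [set: bool] by apply/setP=> -[c i]; rewrite !inE andbT.
by rewrite cardsX cardsT card_bool mulnC.
Qed.

Definition touched d : {set C * bool} := [set p in ends | reach d p].

(** As [opts (mate p)] consists of the missing colours reaching [p], a bad end is reached by few
    colours, or mostly towards one vertex with [d] an exception. *)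
Definition bad_end d p :=
  reach d p && (~~ freeable (mate p) ||
    (if apex (mate p) is Some u then ~~ E d (vx p) u else false)).

Definition bad d : {set C * bool} := [set p in ends | bad_end d p].

Definition good d e := [exists u, [&& u \notin M, E d (vt e false) u & E d (vt e true) u]].

(** Each of the [2 * #|S|] ends is bad for at most five colours: at most five reach it if its mate
    is not freeable, and at most two are exceptions to an apex. *)
Lemma sum_bad : \sum_(d in C0) #|bad d| <= 10 * #|S|.
Proof.
rewrite double_count.
have -> : 10 * #|S| = \sum_(p in ends) 5 by rewrite sum_nat_const card_ends; lia.
apply: leq_sum => p; rewrite inE => pS.
have mp : mate (mate p) = p by rewrite mateK.
have mS : (mate p).1 \in S by [].
case: (boolP (freeable (mate p))) => fy; last first.
  have : #|opts (mate p)| <= 5 by move: fy; rewrite /freeable mS /= -ltnNge.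
  apply: leq_trans; apply: subset_leq_card; apply/subsetP=> d.
  by rewrite !in_set => /andP[-> /andP[]]; rewrite mp => ->.
case ap : (apex (mate p)) => [u|]; last first.
  rewrite (_ : [set i in _ | _] = set0) ?cards0 //; apply/setP=> d.
  by rewrite in_set /bad_end ap fy in_set0 !andbF.
have /(apex_dominates _ fy)/andP[_ h3] := ap.
apply: ltnW; apply: ltnW; apply: ltnW; rewrite !ltnS -ltnS.
apply: leq_ltn_trans h3; apply: subset_leq_card; apply/subsetP=> d.
by rewrite !in_set mp => /andP[-> /andP[->]]; rewrite fy ap /= => ->.
Qed.

Section OneColour.
Variable d : C.
Hypothesis d0 : d \in C0.

Let reachP p : reflect (exists2 u, u \notin M & E d (vx p) u) (reach d p).
Proof.
apply: (iffP existsP) => -[u]; first by case/andP; exists u.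
by move=> h1 h2; exists u; rewrite h1.
Qed.

Let G := touched d :\: bad d.

Let GP p : p \in G -> [/\ p.1 \in S, reach d p, freeable (mate p) &
  forall u, apex (mate p) = Some u -> E d (vx p) u].
Proof.
rewrite in_setD !in_set => /andP[h1 /andP[pS r]]; move: h1.
rewrite pS /bad_end r /= negb_or negbK => /andP[fm ha]; split=> //.
by move=> u hu; move: ha; rewrite hu negbK.
Qed.

Let GI p : p.1 \in S -> reach d p -> p \notin bad d -> p \in G.
Proof. by move=> pS r b; rewrite in_setD b !in_set pS. Qed.

(** The edge to [v] makes [v] the apex of [mate p]; since [p] is not bad, it is joined to [v] too.
    This makes the free vertex [na] of a touched edge unambiguous. *)
Let G_mate_nbr p u v : p \in G -> mate p \in G -> u \notin M -> v \notin M ->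
  E d (vx p) u -> E d (vx (mate p)) v -> u = v.
Proof.
move=> pG mG uF vF pu mv; have [pS rp fm hp] := GP pG.
have /hp := edge_freeable_free d0 fm vF mv.
exact: free_nbr_uniq.
Qed.

Let ET : {set C} := [set p.1 | p in G].

Let na e : option V := [pick u | (u \notin M) && [exists i, ((e, i) \in G) && E d (vt e i) u]].

Let naP p u : p \in G -> u \notin M -> E d (vx p) u -> na p.1 = Some u.
Proof.
move=> pG uF pu; rewrite /na; case: pickP => [v|]; last first.
  move/(_ u); rewrite uF /= => /existsP[]; exists p.2.
  by rewrite -surjective_pairing pG.
case/andP=> vF /existsP[i /andP[iG iv]]; congr Some.
case: (eqVneq i p.2) => [ip|ip].
  apply: (free_nbr_uniq d0 vF uF _ pu).
  by move: iv; rewrite ip.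
have em : mate p = (p.1, i) by rewrite /mate; congr pair; case: i p.2 ip {iG iv} => -[].
by apply/esym; apply: (G_mate_nbr pG) => //; rewrite em.
Qed.

Lemma good_count n w : #|S| <= n -> 3 * n <= #|covered (E d)| + w ->
  n <= #|[set e in S | good d e]| + 8 * w + 9 * #|bad d|.
Proof.
move=> Sn hw; set cov := covered (E d) in hw.
set b := #|bad d|.
pose nu p := [pick u | (u \notin M) && E d (vx p) u].
(* A free covered vertex is joined to a matched end; it is recorded by [na] if that end is not bad
   and by [nu] otherwise. *)
have covU : #|cov :\: M| <= #|na @: ET| + b.
  rewrite -(card_imset (cov :\: M) (@Some_inj _)).
  have sub : Some @: (cov :\: M) \subset (na @: ET) :|: (nu @: bad d).
    apply/subsetP=> _ /imsetP[u /setDP[/coveredP[x ux] uF] ->].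
    have xM : x \in M by apply/negPn/negP=> xF; rewrite (negbTE (free_no_edge hmax d0 uF xF)) in ux.
    have [c cS [i ex]] := matchedP _ _ _ xM.
    have xu : E d (vx (c, i)) u by rewrite /vtx /= -ex sE.
    have r : reach d (c, i) by apply/reachP; exists u.
    rewrite in_setU; case: (boolP ((c, i) \in bad d)) => hb.
      apply/orP; right; apply/imsetP; exists (c, i) => //.
      rewrite /nu; case: pickP => [v /andP[vF xv]|/(_ u)]; last by rewrite uF xu.
      by congr Some; apply: free_nbr_uniq d0 uF vF xu xv.
    have pG : (c, i) \in G by apply: GI.
    apply/orP; left; apply/imsetP; exists c; last by rewrite -(naP pG uF xu).
    by apply/imsetP; exists (c, i).
  apply: leq_trans (subset_leq_card sub) _.
  apply: leq_trans (leq_card_setU _ _) _.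
  by rewrite leq_add2l leq_imset_card.
pose unc := [set p in ends | vx p \notin cov].
have uncE q : (q \in unc) = (q.1 \in S) && (vx q \notin cov).
  by rewrite [LHS]in_set [X in X && _]in_set.
have covM : #|cov :&: M| + #|unc| <= 2 * #|S|.
  rewrite -card_ends -(cardsID unc ends) addnC.
  have -> : ends :&: unc = unc by apply/setIidPr/subsetP=> p; rewrite inE => /andP[].
  rewrite leq_add2l; apply: leq_trans (leq_imset_card vx _).
  apply: subset_leq_card; apply/subsetP=> v /setIP[vc /matchedP[c cS [i ev]]].
  apply/imsetP; exists (c, i) => //.
  by rewrite in_setD uncE mem_ends /= cS /vtx /= -ev vc.
have hcov := cardsID M cov.
have ETS : ET \subset S by apply/subsetP=> _ /imsetP[p /GP[pS _ _ _] ->].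
have cET := subset_leq_card ETS.
have cna := leq_imset_card na ET.
(* A touched edge that is not good shares its free vertex with another one (Na),
   has an uncovered (Nu) or a bad (Nb) end, or meets an untouched edge (Nc). *)
pose Na := [set e in ET | [exists e' in ET, (e' != e) && (na e' == na e)]].
have cNa : #|Na| + 2 * #|na @: ET| <= 2 * #|ET| := card_collisions ET na.
pose Nu := [set p.1 | p in unc].
have cNu : #|Nu| <= #|unc| := leq_imset_card _ _.
pose Nb := [set p.1 | p in bad d].
have cNb : #|Nb| <= b := leq_imset_card _ _.
pose Q := [set p in ends | p.1 \notin ET].
have cQ : #|Q| = 2 * (#|S| - #|ET|).
  have -> : Q = setX (S :\: ET) [set: bool] by apply/setP=> -[c i]; rewrite !inE andbT andbC.
  by rewrite cardsX cardsT card_bool cardsD (setIidPr ETS) mulnC.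
pose Nc := \bigcup_(q in Q) [set p.1 | p in [set p in ends | E d (vx q) (vx p)]].
have cNc : #|Nc| <= 2 * #|Q|.
  apply: leq_trans (card_bigcup_leq _ _) _.
  rewrite mulnC -sum_nat_const; apply: leq_sum => q _.
  apply: leq_trans (leq_imset_card _ _) _.
  apply: leq_trans (dE d (vx q)).
  rewrite -(card_in_imset (f := vx)) => [|p p']; last first.
    by rewrite !in_set => /andP[pS _] /andP[pS' _]; exact: (vtx_inj hE hmax).
  apply: subset_leq_card; apply/subsetP=> _ /imsetP[p hp ->].
  by move: hp; rewrite !in_set => /andP[].
have sub : ET \subset [set e in S | good d e] :|: (Na :|: (Nu :|: (Nb :|: Nc))).
  apply/subsetP=> _ /imsetP[p pG ->].
  have [pS /reachP[u uF xu] fm hp] := GP pG.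
  have pET : p.1 \in ET by apply/imsetP; exists p.
  rewrite !in_setU in_set pS /=.
  case: (boolP (E d (vx (mate p)) u)) => mu.
    apply/orP; left; apply/existsP; exists u; rewrite uF /=.
    by move: xu mu; rewrite /vtx /=; case: p.2 => /= -> ->.
  rewrite orbC -!orbA; case: (boolP (vx (mate p) \in cov)) => hc; last first.
    apply/orP; right; apply/orP; left; apply/imsetP; exists (mate p) => //.
    by rewrite uncE pS hc.
  case: (boolP (mate p \in bad d)) => hb.
    apply/orP; right; apply/orP; right; apply/orP; left.
    by apply/imsetP; exists (mate p).
  have noU v : v \notin M -> ~~ E d (vx (mate p)) v.
    move=> vF; apply/negP=> mv.
    have mG : mate p \in G by apply: GI => //; apply/reachP; exists v.
    by move: mu; rewrite (G_mate_nbr pG mG uF vF xu mv) mv.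
  have /coveredP[x mx] := hc.
  have xM : x \in M by apply/negPn/negP=> xF; rewrite (negbTE (noU _ xF)) in mx.
  have [c cS [i ex]] := matchedP _ _ _ xM.
  pose z := (c, i); have mz : E d (vx (mate p)) (vx z) by rewrite /vtx /= -ex.
  (* On the same matching edge [z] could only be [p], and then transitivity would join [mate p] to
     [u]. *)
  have zp : z.1 != p.1.
    apply/eqP=> zp; case: (eqVneq z (mate p)) => zm.
      by move: mz; rewrite zm iE.
    have zep : z = p.
      move: zm; rewrite /z /mate /= in zp *; rewrite zp [p]surjective_pairing /=.
      by case: i p.2 {ex z mz zp} => -[] //=; rewrite eqxx.
    rewrite zep in mz.
    have um : vx (mate p) != u by apply: contra uF => /eqP<-; apply: vtx_mem.
    by move: mu; rewrite (tE mz xu um).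
  case: (boolP (c \in ET)) => cET'; last first.
    do 3![apply/orP; right]; apply/orP; left; apply/bigcupP; exists z; first by rewrite !in_set cS.
    by apply/imsetP; exists (mate p) => //; rewrite !in_set pS sE.
  have [q qG qc] := imsetP cET'.
  (* A free neighbour of [z] would also be one of [mate p]. So [z] is not the touched end [q] of its
     edge but the opposite end. *)
  have nzu v : v \notin M -> ~~ E d (vx z) v.
    move=> vF; apply/negP=> zv.
    have um : vx (mate p) != v by apply: contra vF => /eqP<-; apply: vtx_mem.
    by move: (noU _ vF); rewrite (tE mz zv um).
  have [qS /reachP[v vF qv] fq hq] := GP qG.
  have zq : z = mate q.
    rewrite /mate -qc /z; congr pair.
    case: (eqVneq i q.2) => iq; last by case: i q.2 iq {ex z mz zp nzu} => -[].
    by move: (nzu _ vF); rewrite /z qc iq -surjective_pairing qv.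
  (* The edge between the freeable ends [mate p] and [mate q] forces a common apex. Neither [p] nor
     [q] is bad, so both are joined to it and the two edges share their free vertex. *)
  have [t mt zt] : exists2 t, apex (mate p) = Some t & apex z = Some t.
    by apply: (edge_freeable2 d0 fm _ _ mz); rewrite // zq.
  have pt := hp _ mt; have tF : t \notin M by move/(apex_dominates _ fm): mt => /andP[].
  have qt : E d (vx q) t by apply: hq; rewrite -zq.
  apply/orP; left; rewrite in_set pET; apply/existsP; exists c; rewrite cET' zp.
  by rewrite qc (naP qG tF qt) (naP pG tF pt) eqxx.
have := subset_leq_card sub.
move/leq_trans/(_ (leq_card_setU _ _)).
move=> h1; have h2 := (leq_card_setU Na (Nu :|: (Nb :|: Nc))).1.
have h3 := (leq_card_setU Nu (Nb :|: Nc)).1; have h4 := (leq_card_setU Nb Nc).1.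
lia.
Qed.

End OneColour.

(** * Matching edges in triangles of most missing colours *)

Definition rigid : {set C} := [set e in S | #|C0| < 2 * #|[set d in C0 | good d e]|].

Notation T := rigid.

Let TS e : e \in T -> e \in S. Proof. by rewrite in_set => /andP[]. Qed.

(** Summing [good_count] over the missing colours, [sum_bad] and the second hypothesis bound the
    total of the bad terms by [#|C0| * w]. On average a colour is thus good for all but [9 * w]
    edges; non-rigid edges have at most half of the colours, which doubles the loss to [18 * w]. *)
Lemma card_rigid w : (forall d, d \in D -> 3 * #|D| <= #|covered (E d)| + w) ->
  90 * #|D| <= #|C0| * w -> #|D| <= #|T| + 18 * w.
Proof.
move=> hcov htw.
have cS : #|S| <= #|D| := subset_leq_card SD.
have s1 : \sum_(d in C0) #|D| <=
    \sum_(d in C0) (#|[set e in S | good d e]| + 8 * w + 9 * #|bad d|).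
  apply: leq_sum => d d0; apply: good_count => //; apply: hcov.
  by case/setDP: d0.
have s9 : \sum_(d in C0) 9 * #|bad d| = 9 * \sum_(d in C0) #|bad d| by rewrite big_distrr.
rewrite 2!big_split /= s9 !sum_nat_const double_count in s1.
have s2 := sum_bad.
have s3 : 2 * (\sum_(e in S) #|[set d in C0 | good d e]|) <= #|S| * #|C0| + #|T| * #|C0|.
  have -> : #|S| * #|C0| + #|T| * #|C0| = \sum_(e in S) (#|C0| + (e \in T) * #|C0|).
    rewrite big_split /= sum_nat_const; congr addn.
    rewrite -big_distrl /= -sum1_card; congr muln.
    rewrite (bigID (mem S)) /= [X in _ + X]big1 ?addn0 => [|e /andP[/TS ->]//].
    rewrite big_mkcond [RHS]big_mkcond; apply: eq_bigr => e _.
    by case: (e \in S); rewrite ?andbF ?andbT //; case: (e \in T).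
  rewrite big_distrr; apply: leq_sum => e eS /=.
  rewrite [e \in T]in_set eS /=; case: ltnP => /= h; last by lia.
  have : #|[set d in C0 | good d e]| <= #|C0|.
    by apply/subset_leq_card/subsetP=> d; rewrite in_set => /andP[].
  lia.
case: (posnP #|C0|) => t0; first by rewrite t0 in htw; lia.
rewrite -(leq_pmul2l t0); move: s1 s2 s3 htw cS.
move: #|C0| #|S| #|D| #|T| (\sum_(e in S) _) (\sum_(d in C0) _) => t s n r x y.
by clear; nia.
Qed.

Hypothesis C0_large : 12 <= #|C0|.

Definition joint e u : {set C} := [set c in C0 | E c (vt e false) u && E c (vt e true) u].

(** More than half of at least twelve colours reach each end, so both ends are freeable. By
    [edge_freeable_free] every good triangle on [e] then has its third vertex at the apex. *)
Lemma rigid_apex e : e \in T -> exists u, (u \notin M) && (#|C0| < 2 * #|joint e u|).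
Proof.
move=> eT; have eS := TS eT; move: eT; rewrite in_set eS /= => hg.
have fr i : freeable (e, i).
  rewrite /freeable eS /=; have : 6 <= #|[set d in C0 | good d e]| by lia.
  move/leq_trans; apply; apply: subset_leq_card; apply/subsetP=> d.
  rewrite in_set => /andP[d0 /existsP[u /and3P[uF u1 u2]]].
  rewrite in_set d0; apply/existsP; exists u; rewrite uF /mate /vtx /=.
  by case: i.
have [d dg] : exists d, d \in [set d in C0 | good d e] by apply/card_gt0P; lia.
move: dg; rewrite in_set => /andP[d0 /existsP[u /and3P[uF u1 u2]]].
have au : apex (e, false) = Some u by apply: (edge_freeable_free d0).
exists u; rewrite uF; apply: leq_trans hg _; rewrite leq_pmul2l //.
apply: subset_leq_card; apply/subsetP=> d'.
rewrite in_set => /andP[d'0 /existsP[v /and3P[vF v1 v2]]].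
have : apex (e, false) = Some v by apply: (edge_freeable_free d'0).
by rewrite au => -[uv]; rewrite in_set d'0 uv v1 v2.
Qed.

(** The default only makes [ap] total; on rigid edges the choice succeeds by [rigid_apex]. *)
Definition ap e : V :=
  odflt (vt e false) [pick u | (u \notin M) && (#|C0| < 2 * #|joint e u|)].

Lemma apP e : e \in T -> ap e \notin M /\ #|C0| < 2 * #|joint e (ap e)|.
Proof.
move=> /rigid_apex[u hu]; rewrite /ap; case: pickP => [v /andP[]//|/(_ u)].
by rewrite hu.
Qed.

(** Two majorities of the missing colours share a colour, in which a common apex would have three
    neighbours. *)
Lemma ap_inj e e' : e \in T -> e' \in T -> ap e = ap e' -> e = e'.
Proof.
move=> eT e'T h; have [uF j] := apP eT; have [_ j'] := apP e'T.
rewrite -h in j'; set u := ap e in uF j j'.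
apply/eqP/negPn/negP=> ee'.
have : 0 < #|joint e u :&: joint e' u|.
  have : #|joint e u :|: joint e' u| <= #|C0|.
    by apply/subset_leq_card/subsetP=> d /setUP[]; rewrite in_set => /andP[].
  have := cardsUI (joint e u) (joint e' u); lia.
case/card_gt0P=> d /setIP[]; rewrite !in_set => /andP[_ /andP[h1 h2]] /andP[_ /andP[h3 _]].
suff : 3 <= #|[set y | E d u y]| by rewrite leqNgt ltnS dE.
have eS := TS eT; have e'S := TS e'T.
have n1 : vt e false != vt e true.
  by apply/eqP=> /(@vtx_inj _ _ _ hE _ _ _ hmax (e, false) (e, true) eS eS).
have n2 i : vt e i != vt e' false.
  by apply/eqP=> /(@vtx_inj _ _ _ hE _ _ _ hmax (e, i) (e', false) eS e'S) [/eqP]; rewrite (negbTE ee').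
have <- : #|[set vt e false; vt e true; vt e' false]| = 3.
  by rewrite setUC cardsU1 cards2 n1 !in_set2 !(eq_sym (vt e' false)) (negbTE (n2 false)) (negbTE (n2 true)).
apply: subset_leq_card; apply/subsetP=> v; rewrite !in_setU !in_set1 => hv.
by rewrite in_set sE; case/orP: hv => [/orP[]|] /eqP->.
Qed.

Definition tri e : {set V} := [set vt e false; vt e true; ap e].

Let triP e v : reflect (v = ap e \/ exists i, v = vt e i) (v \in tri e).
Proof.
rewrite !in_setU !in_set1; apply: (iffP idP).
  by case/orP=> [/orP[]|] /eqP->; [right; exists false|right; exists true|left].
by case=> [->|[[] ->]]; rewrite eqxx ?orbT.
Qed.

Lemma tri_inj e e' v : e \in T -> e' \in T -> v \in tri e -> v \in tri e' -> e = e'.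
Proof.
move=> eT e'T /triP h /triP h'; have [uF _] := apP eT; have [u'F _] := apP e'T.
have nm (k : C) i : k \in T -> vt k i \in M by move=> /TS; apply: mem_matched.
case: h h' => [->|[i ->]] [|[i']] h.
- exact: ap_inj.
- by move: uF; rewrite h nm.
- by move: u'F; rewrite -h nm.
- by case: (@vtx_inj _ _ _ hE _ _ _ hmax (e, i) (e', i') (TS eT) (TS e'T) h).
Qed.

Lemma joint_pick e a b : e \in T ->
  exists c, [/\ c \in C0, forall i, E c (vt e i) (ap e), c != a & c != b].
Proof.
move=> eT; have [_ j] := apP eT.
have j3 : 2 < #|joint e (ap e)| by lia.
have [c [+ ca cb]] := pick_avoid2 a b j3.
by rewrite in_set => /andP[c0 /andP[h1 h2]]; exists c; split=> // -[].
Qed.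

Definition excluded d : {set V} := (M :\: matched T vt) :|: tri d.

(* Free the T-ends among x and y and the colour d by switches at up to three
   distinct edges of T; their apexes differ, so the switches are compatible. *)
Lemma edge_in_tri d x y : d \in T -> x \notin excluded d -> y \notin excluded d ->
  E d x y -> exists e, [/\ e \in T, x \in tri e & y \in tri e].
Proof.
move=> dT; have dS := TS dT; have dD := subsetP SD _ dS.
have class v : v \notin excluded d ->
    (v \notin M /\ v != ap d) \/ exists p, [/\ p.1 \in T, p.1 != d & v = vx p].
  rewrite in_setU negb_or in_setD negb_and negbK => /andP[h vt'].
  have vd : v != ap d by apply: contra vt' => /eqP vd; apply/triP; left.
  case/orP: h => h; last by left.
  right; have [c cT [i vi]] := matchedP _ _ _ h; exists (c, i); split=> //=.
  by apply: contra vt' => /eqP cd; apply/triP; right; exists i; rewrite -cd.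
have [c [c0 hc _ _]] := joint_pick d d dT; have [aF _] := apP dT.
have [cD cS] := setDP c0.
have [S1 [vt1 [m1 [d1 k1] k2 k3 _]]] := maxmatch_switch iE hmax cD cS dS aF (hc false).
have d0 : d \in D :\: S1 by rewrite in_setD d1.
have apF (p : C * bool) : p.1 \in T -> p.1 != d -> ap p.1 \notin matched S1 vt1.
  move=> pT pd; have [pF _] := apP pT; apply: k3 => //.
  by apply: contra pd => /eqP /(ap_inj pT dT)->.
have vx1 p : p.1 \in T -> p.1 != d -> vtx vt1 p = vx p.
  by move=> pT pd; have [_ h] := k2 _ (TS pT) pd; rewrite /vtx h.
have inS1 (p : C * bool) : p.1 \in T -> p.1 != d -> p.1 \in S1.
  by move=> pT pd; have [] := k2 _ (TS pT) pd.
(* After the first switch the other rigid edges keep their ends and apexes, and only [c] has been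
   used up, so each can still be switched at either end. *)
have sw p a : p.1 \in T -> p.1 != d -> exists c', [/\ c' \in D :\: S1,
    E c' (vtx vt1 (mate p)) (ap p.1), d != c' & c' != a].
  move=> pT pd; have [c' [/setDP[c'D c'S] h c'c c'a]] := joint_pick c a pT.
  have c'S1 := k1 _ c'S c'c.
  exists c'; split=> //; first by rewrite in_setD c'S1.
    by rewrite vx1 //; exact: h.
  by apply: contra c'S => /eqP<-.
have mixed p v : p.1 \in T -> p.1 != d -> v \notin M -> v != ap d ->
    E d (vx p) v -> v = ap p.1.
  move=> pT pd vF va pv; apply/eqP/negPn/negP=> vp.
  have [c' [c'0 h dc' _]] := sw p d pT pd.
  have := switch_free_no_edge hE m1 c'0 (inS1 _ pT pd) (apF _ pT pd) h d0 dc' (k3 _ vF va) vp.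
  by rewrite vx1 // pv.
move=> /class[[xF xa]|[p [pT pd ->]]] /class[[yF ya]|[q [qT qd ->]]] xy.
- by move: (free_no_edge m1 d0 (k3 _ xF xa) (k3 _ yF ya)); rewrite xy.
- exists q.1; split=> //; last by apply/triP; right; exists q.2.
  by apply/triP; left; apply: mixed; rewrite // sE.
- exists p.1; split=> //; first by apply/triP; right; exists p.2.
  by apply/triP; left; apply: mixed.
case: (eqVneq q.1 p.1) => qp.
  by exists p.1; split=> //; apply/triP; right; [exists p.2|exists q.2; rewrite -qp].
have [c1 [c10 h1 dc1 _]] := sw p d pT pd.
have [c2 [c20 h2 dc2 c21]] := sw q c1 qT qd.
have aqp : ap q.1 != ap p.1 by apply: contra qp => /eqP /(ap_inj qT pT)->.
have := switch2_no_edge hE m1 c10 (inS1 _ pT pd) (apF _ pT pd) h1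
  c20 (inS1 _ qT qd) (apF _ qT qd) h2 d0 c21 dc1 dc2 aqp qp.
by rewrite !vx1 // xy.
Qed.

(** Away from [excluded d], colour [d] lives inside the triangles [tri e], and it covers all three
    vertices of one only if it joins the ends of [e]. Covering almost [3 * #|D|] vertices needs this
    for almost all [e]; the constant is [73 = 4 * 18 + 1]. *)
Lemma edges_in_own_colours d w : d \in T -> 3 * #|D| <= #|covered (E d)| + w ->
    #|D| <= #|T| + 18 * w ->
  #|D| <= #|[set e in T | E d (vt e false) (vt e true)]| + 73 * w + 9.
Proof.
move=> dT hcov hT; have SDc : #|S| <= #|D| := subset_leq_card SD.
have cT : #|T| <= #|S| by apply/subset_leq_card/subsetP=> e /TS.
set Z := excluded d; pose cv := covered (outside Z (E d)).
have h1 : #|covered (E d)| <= #|cv| + 3 * #|Z|.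
  apply: leq_trans (covered_outside Z (hE d)) _; rewrite leq_add2l leq_pmul2l //.
  exact/subset_leq_card/subsetIl.
have c3 e : #|tri e| <= 3.
  rewrite /tri; apply: leq_trans (leq_card_setU _ _) _.
  by rewrite cards1 cards2 addn1 ltnS; case: (_ != _).
have h2 : #|Z| <= 2 * (#|S| - #|T|) + 3.
  apply: leq_trans (leq_card_setU _ _) _; apply: leq_add (c3 d).
  have <- : #|S :\: T| = #|S| - #|T|.
    by rewrite cardsD; congr (_ - #|pred_of_set _|); apply/setIidPr/subsetP=> e /TS.
  apply: leq_trans (card_matched (S :\: T) vt); apply: subset_leq_card.
  apply/subsetP=> v /setDP[/matchedP[c cS [i ->]] vT]; apply: mem_matched.
  by rewrite in_setD cS andbT; apply: contra vT; exact: mem_matched.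
have nbr v : v \in cv -> exists e y, [/\ e \in T, v \in tri e, y \in tri e & E d v y].
  case/coveredP=> y /and3P[vy vZ yZ].
  by have [e [eT ve ye]] := edge_in_tri dT vZ yZ vy; exists e, y.
have h3 : #|cv| <= \sum_(e in T) #|tri e :&: cv|.
  apply: leq_trans (card_bigcup_leq _ _); apply: subset_leq_card.
  apply/subsetP=> v vc; have [e [y [eT ve _ _]]] := nbr v vc.
  by apply/bigcupP; exists e => //; rewrite in_setI ve.
have h4 : \sum_(e in T) #|tri e :&: cv| <=
    \sum_(e in T) (2 + E d (vt e false) (vt e true)).
  apply: leq_sum => e eT; have : #|tri e :&: cv| <= #|tri e|.
    exact/subset_leq_card/subsetIl.
  case: (boolP (E d (vt e false) (vt e true))) => he hle.
    by apply: leq_trans hle (c3 e).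
  rewrite addn0 -ltnS; apply: leq_trans (c3 e); apply: proper_card.
  rewrite properEneq subsetIl andbT; apply/eqP=> /setIidPl/subsetP sub.
  (* If all three vertices were covered but the ends not joined, each end would have only the apex
     as neighbour in its triangle, and transitivity would join the ends. *)
  have to_ap i : E d (vt e i) (ap e).
    have ve : vt e i \in tri e by apply/triP; right; exists i.
    have [e' [y [e'T ve' ye' vy]]] := nbr _ (sub _ ve).
    have ee' := tri_inj eT e'T ve ve'; rewrite -ee' in ye'.
    case/triP: ye' vy => [->//|[j ->]] vy; exfalso; move/negP: he; apply.
    by case: i j {ve ve'} vy => -[] //; rewrite ?iE // sE.
  move/negP: he; apply; apply: tE (to_ap false) _ _; first by rewrite sE.
  by apply/eqP=> /(@vtx_inj _ _ _ hE _ _ _ hmax (e, false) (e, true) (TS eT) (TS eT)).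
have h5 : \sum_(e in T) (2 + E d (vt e false) (vt e true)) =
    2 * #|T| + #|[set e in T | E d (vt e false) (vt e true)]|.
  rewrite big_split /= sum_nat_const mulnC; congr addn.
  by rewrite -sum1dep_card big_mkcondr.
move: h1 h2 h3 h4 h5 hcov hT SDc cT; clear; lia.
Qed.

End MaximumMatching.

Lemma maxmatch_exists (C V : finType) (E : C -> rel V) (D : {set C}) (v0 : V) :
  exists S vt, maxmatch E D S vt.
Proof.
pose P k := `[< exists (S : {set C}) vt, [/\ S \subset D, rmatch E S vt & #|S| = k] >].
have P0 : exists k, P k.
  exists 0; apply/asboolP; exists set0, (fun _ _ => v0); split.
  - exact: sub0set.
  - by split=> [c|c c' i j]; rewrite inE.
  - exact: cards0.
have Pb k : P k -> k <= #|D|.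
  by move/asboolP=> [S [vt [sD _ <-]]]; exact: subset_leq_card.
have [k /asboolP[S [vt [sD mS cS]]] kmax] := ex_maxnP P0 Pb.
exists S, vt; split=> // S' vt' sD' mS'; rewrite cS; apply: kmax.
by apply/asboolP; exists S', vt'.
Qed.

(** With more than [t] colours missing, [edges_in_own_colours] and double counting over pairs of
    rigid colours would give some rigid edge at least [#|D| - 73 * w - 9] parallel colours, more
    than [mu]. *)
Lemma almost_full_matching (C V : finType) (E : C -> rel V) (D : {set C}) mu w t :
    (forall c, small_cliques (E c)) ->
    (forall c, c \in D -> 3 * #|D| <= #|covered (E c)| + w) ->
    (forall x y, #|[set c in D | E c x y]| <= mu) ->
    mu + 73 * w + 9 < #|D| -> 90 * #|D| <= t * w ->
  exists (S : {set C}) vt, [/\ S \subset D, rmatch E S vt & #|D| <= #|S| + t].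
Proof.
move=> hE hcov hmu hn ht.
have [c cD] : exists c, c \in D by apply/card_gt0P; lia.
have [v0 _] : exists v, v \in covered (E c) by apply/card_gt0P; have := hcov _ cD; lia.
have [S [vt hmax]] := maxmatch_exists E D v0.
have [SD mS _] := hmax.
exists S, vt; split=> //; rewrite leqNgt; apply/negP=> hS.
have cC0 : #|D :\: S| + #|S| = #|D| by rewrite cardsD (setIidPr SD) subnK ?subset_leq_card.
have htw : 90 * #|D| <= #|D :\: S| * w by apply: leq_trans ht _; rewrite leq_mul2r; lia.
(* Combine [htw] with [73 * w < #|D|], a consequence of [hn]. *)
have C0_large : 12 <= #|D :\: S| by nia.
have hT := card_rigid hE hmax hcov htw.
set T := rigid E D S vt in hT.
have s1 : \sum_(d in T) #|D| <=
    \sum_(d in T) (#|[set e in T | E d (vt e false) (vt e true)]| + (73 * w + 9)).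
  apply: leq_sum => d dT; rewrite addnA.
  have dD : d \in D by apply: (subsetP SD); move: dT; rewrite in_set => /andP[].
  exact: (edges_in_own_colours hE hmax C0_large dT (hcov _ dD) hT).
rewrite big_split /= !sum_nat_const double_count in s1.
have s2 : \sum_(e in T) #|[set d in T | E d (vt e false) (vt e true)]| <= #|T| * mu.
  rewrite -sum_nat_const; apply: leq_sum => e _; apply: leq_trans (hmu (vt e false) (vt e true)).
  apply/subset_leq_card/subsetP=> d; rewrite !in_set => /andP[/andP[dS _] ->].
  by rewrite (subsetP SD).
move: s1 s2 hT hn; move: #|T| #|D| (\sum_(e in T) _) => r n x; clear; nia.
Qed.

(** * The reserve *)

Section RandomSet.
Variables (V : finType) (q : nat).
Notation Q := q.+1.
Notation Omega := {ffun V -> 'I_Q}.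
Implicit Types (A B : {set V}) (h : Omega).

(** For uniform [h] this is a random set containing each vertex independently with probability
    [1 / Q]; probabilities are expressed as counts in [Omega]. *)
Definition zeros h : {set V} := [set x | h x == ord0].

Lemma card_subset_zeros A :
  #|[set h : Omega | A \subset zeros h]| * Q ^ #|A| = #|{: Omega}|.
Proof.
have -> : #|[set h : Omega | A \subset zeros h]| = Q ^ #|~: A|.
  rewrite -[Q in Q ^ _]card_ord -(card_pffun_on ord0 (mem (~: A)) (mem 'I_Q)).
  rewrite cardsE; apply: eq_card => h; rewrite !inE /=.
  apply/subsetP/pffun_onP => [sA|[sA _] x xA].
    split=> [|x]; last by [].
    apply/subsetP=> x; rewrite unfold_in /= inE; apply: contra => /sA.
    by rewrite inE.
  rewrite inE; apply/negPn/negP=> hx; have := subsetP sA x.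
  by rewrite unfold_in /= inE xA => /(_ hx).
by rewrite card_ffun card_ord -expnD addnC cardsC.
Qed.

Variables (F : {set {set V}}) (k : nat).
Hypothesis tF : trivIset F.
Hypothesis kF : forall B, B \in F -> #|B| = k.
Hypothesis k_gt0 : 0 < k.

Definition hits h := #|[set B in F | B \subset zeros h]|.

Lemma sum_hits : (\sum_(h : Omega) hits h) * Q ^ k = #|F| * #|{: Omega}|.
Proof.
have -> : \sum_(h : Omega) hits h = \sum_(B in F) #|[set h : Omega | B \subset zeros h]|.
  have := double_count [set: Omega] F (fun h B => B \subset zeros h).
  rewrite (eq_bigl xpredT) => [->|h]; last by rewrite in_setT.
  by apply: eq_bigr => B _; apply: eq_card => h; rewrite !inE.
rewrite big_distrl /= -sum_nat_const; apply: eq_bigr => B BF.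
by rewrite -(kF BF) card_subset_zeros.
Qed.

(** Distinct blocks are disjoint, so their events are independent and contribute at most the squared
    mean; the diagonal adds the mean. *)
Lemma sum_hits2 :
  (\sum_(h : Omega) hits h ^ 2) * Q ^ (2 * k) <= #|{: Omega}| * (#|F| * Q ^ k + #|F| ^ 2).
Proof.
have -> : \sum_(h : Omega) hits h ^ 2 =
    \sum_(B in F) \sum_(B' in F) #|[set h : Omega | B :|: B' \subset zeros h]|.
  have hitsE h : hits h = \sum_(B in F) (B \subset zeros h).
    by rewrite /hits -sum1dep_card big_mkcondr.
  transitivity (\sum_(h : Omega) \sum_(B in F) \sum_(B' in F) (B :|: B' \subset zeros h)).
    apply: eq_bigr => h _; rewrite hitsE -mulnn big_distrl; apply: eq_bigr => B _ /=.
    rewrite big_distrr; apply: eq_bigr => B' _ /=.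
    by rewrite subUset mulnb.
  rewrite exchange_big; apply: eq_bigr => B _ /=.
  rewrite exchange_big; apply: eq_bigr => B' _ /=.
  by rewrite -sum1dep_card [RHS]big_mkcond; apply: eq_bigr => h _; case: (_ \subset _).
have -> : #|{: Omega}| * (#|F| * Q ^ k + #|F| ^ 2) =
    \sum_(B in F) \sum_(B' in F) ((B' == B) * (#|{: Omega}| * Q ^ k) + #|{: Omega}|).
  under eq_bigr => B BF.
    rewrite big_split /= sum_nat_const (bigD1 B) //= eqxx mul1n big1 ?addn0 => [|B' /andP[_ /negbTE->]//].
    over.
  by rewrite sum_nat_const -mulnn; move: #|F| (Q ^ k) => r Y; lia.
rewrite big_distrl; apply: leq_sum => B BF /=.
rewrite big_distrl; apply: leq_sum => B' B'F /=.
case: eqVneq => [->|BB'].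
  have cz : #|[set h : Omega | B \subset zeros h]| * Q ^ k = #|{: Omega}|.
    by rewrite -(kF BF) card_subset_zeros.
  rewrite setUid mul1n mul2n -addnn expnD mulnA cz.
  exact: leq_addr.
rewrite mul0n add0n -(card_subset_zeros (B :|: B')).
have -> // : #|B :|: B'| = 2 * k.
have : [disjoint B & B'] by apply: (trivIsetP tF); rewrite // eq_sym.
by rewrite -leq_card_setU => /eqP->; rewrite (kF BF) (kF B'F) mul2n addnn.
Qed.

(* Chebyshev's inequality: [hits] has mean |F| / Q^k. *)
Lemma deviation_bound :
  #|[set h : Omega | (2 * (hits h * Q ^ k) < #|F|) || (2 * #|F| < hits h * Q ^ k)]| * #|F|
    <= 4 * #|{: Omega}| * Q ^ k.
Proof.
set X := [set h | _]; set r := #|F|.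
case: (posnP r) => [->|r0]; first by rewrite muln0.
(* With [x = hits h * Q ^ k] this says that [4 * (x - r) ^ 2] is at least [r ^ 2] on [X] and
   nonnegative elsewhere, written without subtraction. *)
have pt h : (h \in X) * r ^ 2 + 8 * (hits h * Q ^ k) * r <=
    4 * (hits h ^ 2 * Q ^ (2 * k)) + 4 * r ^ 2.
  rewrite in_set -/r mulnC (mulnC 2 k) expnM; move: (Q ^ k) => Y.
  rewrite -expnMn; move: (hits h * Y) => x.
  have ex (a b : nat) : a <= b -> exists d, b = a + d by exists (b - a); lia.
  rewrite -!mulnn; clear -ex; case: orP => [[/ltnW/ex[d ->]|/ltnW/ex[d ->]]|_]; try nia.
  by case: (leqP x r) => [/ex[d ->]|/ltnW/ex[d ->]]; nia.
have : \sum_(h : Omega) ((h \in X) * r ^ 2 + 8 * (hits h * Q ^ k) * r) <=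
    \sum_(h : Omega) (4 * (hits h ^ 2 * Q ^ (2 * k)) + 4 * r ^ 2).
  by apply: leq_sum.
have e1 : \sum_(h : Omega) (h \in X) * r ^ 2 = #|X| * r ^ 2.
  rewrite -big_distrl /=; congr muln; rewrite -sum1_card [RHS]big_mkcond.
  by apply: eq_bigr => h _; case: (h \in X).
have e2 : \sum_(h : Omega) 8 * (hits h * Q ^ k) * r = 8 * (r * #|{: Omega}|) * r.
  by rewrite -big_distrl -big_distrr /= -big_distrl /= sum_hits.
have e3 : \sum_(h : Omega) 4 * (hits h ^ 2 * Q ^ (2 * k)) =
    4 * ((\sum_(h : Omega) hits h ^ 2) * Q ^ (2 * k)).
  by rewrite -big_distrr -big_distrl.
have e4 : \sum_(h : Omega) 4 * r ^ 2 = #|{: Omega}| * (4 * r ^ 2) by rewrite sum_nat_const.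
rewrite [X in X <= _]big_split [X in _ <= X]big_split e1 e2 e3 e4 /=.
move: sum_hits2; rewrite -/r; move: (\sum_(h : Omega) _) => s.
clear pt e1 e2 e3 e4; clearbody r.
move: (Q ^ (2 * k)) (Q ^ k) #|X| #|{: Omega}| => Y2 Y x O h1 h2.
have : x * r ^ 2 <= 4 * (O * (r * Y)) by nia.
nia.
Qed.

End RandomSet.

Section Reserve.
Variables (C V : finType) (E : C -> rel V) (q : nat).
Hypothesis hE : forall c, small_cliques (E c).
Hypothesis C_large : 3 <= #|C|.
Hypothesis cov_large : forall c, 2 * #|C| <= #|covered (E c)|.
Notation Q := q.+1.
Notation Omega := {ffun V -> 'I_Q}.

(** The deviation bound is applied to the covered vertices as singletons, so that [W] takes few of
    them, and to a family of disjoint edges, so that many edges of the colour fall inside [W]. *)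
Lemma reserve_exists : exists (W : {set V}) (X : {set C}), #|X| <= 28 * Q ^ 2 /\
  forall c, c \notin X -> #|W :&: covered (E c)| * Q <= 2 * #|covered (E c)| /\
    #|C| <= 12 * Q ^ 2 * #|covered (outside (~: W) (E c))|.
Proof.
have hF c : exists F : {set {set V}}, [/\ trivIset F, #|F| = #|C| %/ 3 &
    forall B, B \in F -> exists x y, E c x y /\ B = [set x; y]].
  by apply: disjoint_edges (hE c) _; apply: leq_trans (cov_large c); lia.
have [F2 hF2] := fin_all_exists hF.
pose F1 c : {set {set V}} := [set [set x] | x in covered (E c)].
have tF1 c : trivIset (F1 c).
  apply/trivIsetP=> _ _ /imsetP[x _ ->] /imsetP[y _ ->] xy.
  by rewrite disjoints1 in_set1; apply: contra xy => /eqP->.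
have cF1 c : #|F1 c| = #|covered (E c)| by apply: card_imset; exact: set1_inj.
have kF1 c B : B \in F1 c -> #|B| = 1 by case/imsetP=> x _ ->; rewrite cards1.
have kF2 c B : B \in F2 c -> #|B| = 2.
  have [_ _ h] := hF2 c; case/h=> x [y [xy ->]]; rewrite cards2.
  have [_ iE _ _] := hE c.
  by case: eqVneq => // xy'; rewrite xy' iE in xy.
pose dev (F : {set {set V}}) k : {set Omega} := [set h | (2 * (hits F h * Q ^ k) < #|F|) || (2 * #|F| < hits F h * Q ^ k)].
pose dv c := dev (F1 c) 1 :|: dev (F2 c) 2.
have dvc c : #|dv c| <= #|{: Omega}| * (28 * Q ^ 2) %/ #|C|.
  rewrite leq_divRL; last by lia.
  have d1 := @deviation_bound V q (F1 c) 1 (tF1 c) (kF1 c) isT.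
  have [tF2 cF2 _] := hF2 c.
  have d2 := @deviation_bound V q (F2 c) 2 tF2 (kF2 c) isT.
  rewrite -/(dev (F1 c) 1) cF1 in d1; rewrite -/(dev (F2 c) 2) cF2 in d2.
  have d3 : #|dv c| <= #|dev (F1 c) 1| + #|dev (F2 c) 2| by rewrite leq_card_setU.
  have hc := cov_large c; move: d1 d2 d3 hc C_large.
  move: #|dv c| #|dev _ 1| #|dev _ 2| #|C| #|covered _| #|{: Omega}|.
  clear=> x y z n r O; rewrite expn1 -mulnn => d1 d2 d3 hc hn.
  (* Rounding costs at most a factor 2 because [n >= 3]. The two families contribute 4 and 24 to the
     constant 28. *)
  have : n <= 6 * (n %/ 3) by lia.
  move: (n %/ 3) d2 => m d2 hm.
  have : y * n <= 4 * O * (q.+1 * q.+1) by nia.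
  have : z * n <= 24 * O * (q.+1 * q.+1) by nia.
  nia.
(* The average number of deviating colours over [Omega] obeys this bound, so some [h] does too. *)
have [h hh] : exists h : Omega, #|[set c | h \in dv c]| <= 28 * Q ^ 2.
  apply/existsP; rewrite -[X in is_true X]negbK negb_exists; apply/negP=> /forallP hb.
  have : \sum_(h : Omega) (28 * Q ^ 2).+1 <= \sum_(h : Omega) #|[set c | h \in dv c]|.
    by apply: leq_sum => h _; rewrite ltnNge.
  have -> : \sum_(h : Omega) #|[set c | h \in dv c]| = \sum_(c : C) #|dv c|.
    have := double_count [set: Omega] [set: C] (fun h c => h \in dv c).
    rewrite (eq_bigl xpredT) => [|h]; last by rewrite in_setT.
    rewrite [RHS](eq_bigl xpredT) => [|c]; last by rewrite in_setT.
    under eq_bigr => h _ do under eq_finset => c do rewrite in_setT.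
    move=> ->; apply: eq_bigr => c _; apply: eq_card => h.
    by rewrite in_set in_setT.
  rewrite sum_nat_const => h1.
  have h2 : \sum_(c : C) #|dv c| <= #|{: Omega}| * (28 * Q ^ 2).
    apply: leq_trans (leq_trunc_div _ #|C|).
    by rewrite mulnC -sum_nat_const; apply: leq_sum => c _.
  have h3 : 0 < #|{: Omega}| by rewrite card_ffun card_ord expn_gt0.
  have := leq_trans h1 h2; rewrite leq_pmul2l //; lia.
exists (zeros h), [set c | h \in dv c]; split=> // c.
rewrite in_set in_setU negb_or => /andP[]; rewrite in_set [h \in dev (F2 c) 2]in_set.
rewrite !negb_or -!leqNgt => /andP[_ l1] /andP[l2 _].
split.
  have -> : #|zeros h :&: covered (E c)| = hits (F1 c) h.
    rewrite /hits -(card_imset _ (@set1_inj V)); apply: eq_card => B.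
    apply/imsetP/idP => [[x /setIP[xz xc] ->]|].
      by rewrite in_set sub1set xz andbT; apply/imsetP; exists x.
    rewrite in_set => /andP[/imsetP[x xc ->]]; rewrite sub1set => xz.
    by exists x => //; rewrite in_setI xz.
  by move: l1; rewrite cF1 expn1.
have [tF2 cF2 eF2] := hF2 c.
have hN : hits (F2 c) h <= #|covered (outside (~: zeros h) (E c))|.
  set G := [set B in F2 c | B \subset zeros h].
  have GF : G \subset F2 c by apply/subsetP=> B; rewrite in_set => /andP[].
  have cG : #|cover G| = #|G| * 2.
    rewrite -sum_nat_const -(eqP (trivIsetS GF tF2)); apply: eq_bigr => B BG.
    exact: kF2 (subsetP GF _ BG).
  have : #|cover G| <= #|covered (outside (~: zeros h) (E c))|.
    apply: subset_leq_card; apply/subsetP=> v /bigcupP[B].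
    rewrite in_set => /andP[/eF2[x [y [xy ->]]]]; rewrite subUset !sub1set => /andP[xz yz].
    have [sE _ _ _] := hE c.
    have xyo : outside (~: zeros h) (E c) x y by rewrite /outside /= xy !in_setC !negbK xz.
    rewrite in_set2 => /orP[] /eqP->; apply/coveredP; first by exists y.
    by exists x; rewrite /outside /= sE xy !in_setC !negbK xz yz.
  by rewrite cG; rewrite -/(hits (F2 c) h); lia.
rewrite cF2 in l2; move: l2 hN C_large; move: (hits _ _) #|covered _| #|C| (Q ^ 2).
clear=> x y n Y h1 h2 h3; have h4 : n <= 6 * (n %/ 3) by lia.
have h5 : x * Y <= y * Y by rewrite leq_mul2r h2 orbT.
by move: (n %/ 3) h1 h4 => m; lia.
Qed.

End Reserve.

(** * Greedy completion and combination of matchings *)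

Section Assembly.
Variables (C V : finType) (E : C -> rel V).
Hypothesis hE : forall c, small_cliques (E c).

(** Each new edge adds at most two matched vertices in [W] while [L] loses a colour, so the
    hypothesis is preserved by the induction. *)
Lemma greedy_matching (W : {set V}) (L S : {set C}) vt : rmatch E S vt -> [disjoint L & S] ->
    (forall c, c \in L ->
      3 * (#|matched S vt :&: W| + 2 * #|L|) < #|covered (outside (~: W) (E c))|) ->
  exists vt', rmatch E (L :|: S) vt'.
Proof.
elim: {L}_.+1 {-2}L (ltnSn #|L|) S vt => // k IH L Lk S vt mS LS hL.
have [->|[c cL]] := set_0Vmem L; first by exists vt; rewrite set0U.
have cS : c \notin S by apply: contraTN cL => cS; rewrite (disjointFl LS).
have h0 := hL c cL.
have [x [y]] : exists x y, [&& outside (~: W) (E c) x y,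
    x \notin matched S vt :&: W & y \notin matched S vt :&: W].
  by apply: edge_outside; [exact: small_cliques_outside|lia].
rewrite /outside /= !in_setC !negbK !in_setI => /and3P[/and3P[xy xW yW]].
rewrite xW yW !andbT => xF yF.
have mS' := rmatch_add mS cS xy xF yF.
set vt' := (fun k => _) in mS'.
have cL' : #|L| = #|L :\ c|.+1 by rewrite (cardsD1 c L) cL.
have sub : matched (c |: S) vt' :&: W \subset [set x; y] :|: (matched S vt :&: W).
  apply/subsetP=> v /setIP[/matchedP[k' /setU1P[->|kS] [i ->]] vW].
    by rewrite /vt' eqxx !inE; case: (i); rewrite eqxx ?orbT.
  have vtk : vt' k' = vt k'.
    by rewrite /vt'; case: eqP => // kc; rewrite -kc kS in cS.
  by rewrite vtk in vW *; rewrite in_setU in_setI vW mem_matched ?orbT.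
have cm : #|matched (c |: S) vt' :&: W| <= 2 + #|matched S vt :&: W|.
  apply: leq_trans (subset_leq_card sub) _; apply: leq_trans (leq_card_setU _ _) _.
  by rewrite leq_add2r cards2; case: (_ != _).
have [] := IH (L :\ c) _ (c |: S) vt' mS'.
- by move: Lk; rewrite cL'.
- rewrite disjoint_sym disjoints_subset subUset sub1set in_setC in_setD1 eqxx /=.
  by rewrite disjoint_sym disjoints_subset in LS; apply: subset_trans LS _; rewrite setCS subD1set.
- move=> c' /setD1P[_ /hL]; apply: leq_ltn_trans; rewrite leq_pmul2l //; lia.
by move=> vt2 m2; exists vt2; rewrite setUA (setUC _ [set c]) setD1K in m2.
Qed.

Lemma union_matching (S1 S2 : {set C}) (Z : {set V}) vt1 vt2 :
    [disjoint S1 & S2] -> rmatch E S1 vt1 -> matched S1 vt1 \subset Z ->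
    rmatch (fun c => outside Z (E c)) S2 vt2 ->
  let vt c := if c \in S1 then vt1 c else vt2 c in
  rmatch E (S1 :|: S2) vt /\ matched (S1 :|: S2) vt :&: Z \subset matched S1 vt1.
Proof.
move=> dS [e1 f1] mZ [e2 f2] vt.
have vtl c : c \in S1 -> vt c = vt1 c by rewrite /vt => ->.
have vtr c : c \in S2 -> vt c = vt2 c by rewrite /vt => cS; rewrite (disjointFl dS cS).
have inZ c i : c \in S1 -> vt1 c i \in Z by move=> cS; apply/(subsetP mZ)/mem_matched.
have outZ c i : c \in S2 -> vt2 c i \notin Z.
  by move=> /e2 /and3P[_ h1 h2]; case: i.
split; first split.
- move=> c /setUP[cS|cS]; first by rewrite vtl // e1.
  by rewrite vtr //; have /and3P[] := e2 c cS.
- move=> c c' i j /setUP[] cS /setUP[] cS' cc'.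
  + by rewrite !vtl // f1.
  + by rewrite vtl // vtr //; apply: contra (outZ _ j cS') => /eqP<-; exact: inZ.
  + by rewrite vtr // vtl //; apply: contra (outZ _ i cS) => /eqP->; exact: inZ.
  + by rewrite !vtr // f2.
- apply/subsetP=> v /setIP[/matchedP[c /setUP[] cS [i ->]]]; first by rewrite vtl // mem_matched.
  by rewrite vtr // (negbTE (outZ _ i cS)).
Qed.

End Assembly.

(* Parameters: w = 10 (n / (1000 s)) for the coverage defect, vertices kept for
   the reserve with probability 1 / (18000 s), and 18000 s leftover colours. *)
Lemma full_matching (s : nat) : 0 < s -> exists N, forall n, N <= n ->
  forall (V : finType) (E : 'I_n -> rel V), (forall c, small_cliques (E c)) ->
    (forall c, 3000 * s * n <= 1000 * s * #|covered (E c)| + n) ->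
    (forall x y, s * #|[set c | E c x y]| + n <= s * n) ->
  exists vt, rmatch E [set: 'I_n] vt.
Proof.
move=> s0; pose q := (18 * 1000 * s).-1; pose Q2 := q.+1 ^ 2; pose B := 28 * Q2.
pose t := 18 * 1000 * s.
(* The first summand ensures [B + 10 <= a]; the second leaves room in the reserve for the leftover
   colours. *)
exists (1000 * s * (B + 10) + 12 * Q2 * (6 * B + 6 * t)).+1 => n hn V E hE hcov hmu.
pose a := n %/ (1000 * s).
have s1 : 0 < 1000 * s by rewrite muln_gt0.
have an : 1000 * s * a <= n by rewrite mulnC leq_trunc_div.
have na : n < 1000 * s * a.+1 by rewrite mulnC -ltn_divLR.
have aB : B + 10 <= a by rewrite leq_divRL // mulnC; lia.
have aB2 : 12 * Q2 * (6 * B + 6 * t) < n by lia.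
have an' : 1000 * a <= n by apply: leq_trans an; rewrite -mulnA leq_mul2l leq_pmull.
have hc c : 3 * n <= #|covered (E c)| + a.+1.
  rewrite -(leq_pmul2l s1) mulnDr; apply: leq_trans (leq_add (leqnn _) (ltnW na)).
  by apply: leq_trans (hcov c); rewrite -!mulnA mulnCA; lia.
have hm x y : #|[set c | E c x y]| + 1000 * a <= n.
  rewrite -(leq_pmul2l s0) mulnDr; apply: leq_trans (hmu x y); rewrite leq_add2l.
  by rewrite mulnCA mulnA.
have n3 : 3 <= #|'I_n| by rewrite card_ord; lia.
have c2 c : 2 * #|'I_n| <= #|covered (E c)| by rewrite card_ord; have := hc c; lia.
have [W [X [cX hW]]] := reserve_exists q hE n3 c2.
rewrite -/Q2 -/B card_ord in cX hW.
have [v0 _] : exists v : V, v \in [set: V].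
  have i0 : 'I_n by apply: (Ordinal (n:=n) (m:=0)); lia.
  have : 0 < #|covered (E i0)| by have := c2 i0; lia.
  by case/card_gt0P=> v _; exists v; rewrite in_setT.
have m0 : rmatch E set0 (fun _ _ => v0) by split=> [c|c c' i j]; rewrite in_set0.
(* The at most [B] exceptional colours are matched first, with the whole vertex set available. *)
have [|c cX'|vtX mX] := greedy_matching (W := [set: V]) (L := X) hE m0.
- by rewrite disjoint_sym disjoints_subset sub0set.
- rewrite /matched big_set0; have := covered_outside (~: [set: V]) (hE c).
  rewrite setCT !set0I cards0; have := hc c; lia.
rewrite setU0 in mX.
pose Z := W :|: matched X vtX.
pose E' c := outside Z (E c).
have hE' c : small_cliques (E' c) by exact: small_cliques_outside.
have cD : #|~: X| = n - #|X| by rewrite cardsCs setCK card_ord.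
have cM := card_matched X vtX.
have covE' c : c \in ~: X -> 3 * #|~: X| <= #|covered (E' c)| + 10 * a.
  rewrite in_setC => /hW[h1 _]; have h2 := covered_outside Z (hE c).
  have h3 : #|Z :&: covered (E c)| <= #|W :&: covered (E c)| + 2 * #|X|.
    rewrite setIUl; apply: leq_trans (leq_card_setU _ _) _; rewrite leq_add2l.
    exact: leq_trans (subset_leq_card (subsetIl _ _)) cM.
  have h4 := hc c; rewrite cD; rewrite -/(E' c) in h2.
  have h5 : 9 * 1000 * #|W :&: covered (E c)| <= #|covered (E c)|.
    have : #|W :&: covered (E c)| * (18 * 1000) <= #|W :&: covered (E c)| * q.+1.
      by rewrite leq_mul2l /q prednK ?muln_gt0 // leq_pmulr // orbT.
    move/leq_trans/(_ h1); move: #|W :&: _| #|covered _| => x y; clear; lia.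
  have h6 : #|covered (E c)| <= 4 * n -> 3 * #|W :&: covered (E c)| <= 2 * a.+1.
    move=> c4; rewrite -(leq_pmul2l s1).
    have h7 : q.+1 = 18 * (1000 * s) by rewrite /q prednK ?muln_gt0 // !mulnA.
    move: h1 c4 na; rewrite h7; move: #|W :&: _| #|covered _| (1000 * s) => x y z.
    clear; nia.
  (* Up to [4 * n] covered vertices the reserve costs at most [2 * a.+1]; beyond that, [h5] limits
     the loss to a small fraction, which leaves more than enough. *)
  case: (leqP #|covered (E c)| (4 * n)) => [/h6 h7|h7]; lia.
have muE' x y : #|[set c in ~: X | E' c x y]| <= n - 1000 * a.
  have : #|[set c in ~: X | E' c x y]| <= #|[set c | E c x y]|.
    by apply/subset_leq_card/subsetP=> c; rewrite !in_set => /andP[_ /and3P[]].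
  have := hm x y; lia.
have [] := almost_full_matching (t := t) hE' covE' muE'.
- by rewrite cD; lia.
- rewrite cD; apply: (@leq_trans (90 * n)); first by rewrite leq_mul2l leq_subr orbT.
  have : 1000 * s <= 1000 * s * a by rewrite leq_pmulr //; lia.
  by rewrite /t; move: na; rewrite mulnS; lia.
move=> S [vtS [SX mS cS]].
have dS : [disjoint X & S] by rewrite disjoint_sym disjoints_subset.
have [mU sU] := union_matching dS mX (subsetUr _ _) mS.
set vt := (fun c => _) in mU sU.
have cL : #|~: (X :|: S)| <= t.
  by rewrite setCU -setDE cardsD (setIidPr SX) leq_subLR.
(* The matching built so far meets [W] only in vertices used for [X], at most [2 * B]. With at most
   [t] leftover colours the requirement is [3 * (2 * B + 2 * t)] covered vertices inside [W]. *)
have [||vt' m'] := greedy_matching (W := W) (L := ~: (X :|: S)) hE mU.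
- by rewrite disjoints_subset.
- move=> c; rewrite in_setC in_setU negb_or => /andP[/hW[_ h2] _].
  have h3 : #|matched (X :|: S) vt :&: W| <= 2 * #|X|.
    apply: leq_trans cM; apply: subset_leq_card; apply: subset_trans sU.
    exact/setIS/subsetUl.
  have h4 : 12 * Q2 * (6 * B + 6 * t) < 12 * Q2 * #|covered (outside (~: W) (E c))|.
    exact: leq_trans aB2 h2.
  have h5 : 6 * B + 6 * t < #|covered (outside (~: W) (E c))|.
    by move: h4; rewrite ltn_mul2l => /andP[].
  by move: h3 h5 cL cX; clear; lia.
by exists vt'; rewrite setUC setUCr in m'.
Qed.

(** * Passage from real parameters and arbitrary cliques to the discrete statement *)

Import Order.TTheory GRing.Theory Num.Theory.
Local Open Scope ring_scope.

Theorem theorem3p2 (R : realType) (delta : R) (hdelta : 0 < delta) :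
  exists2 delta' : R, 0 < delta' &
  exists N : nat, forall n : nat, (N <= n)%N ->
  forall (V : finType) (P : 'I_n -> {set {set V}}),
    nv_multigraph P ((3 - delta') * n%:R) ->
    multiplicity_le P ((1 - delta) * n%:R) ->
    exists M : {set 'I_n * (V * V)}, rainbow_matching P M /\ #|M| = n.
Proof.
(* As [s] exceeds [1 / delta], the multiplicity is at most [(1 - 1 / s) * n]. *)
pose s := (Num.bound delta^-1).+1.
have hs : 1 <= delta * s%:R.
  have h : delta^-1 < s%:R.
    have d0 : 0 <= delta^-1 by rewrite invr_ge0 ltW.
    by apply: lt_trans (archi_boundP d0) _; rewrite ltr_nat.
  by rewrite -ler_pdivrMl // mulr1 ltW.
have [N hN] := full_matching (ltn0Sn _ : (0 < s)%N).
have s0 : 0 < s%:R :> R by rewrite ltr0n.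
exists (1000 * s)%N%:R^-1; first by rewrite invr_gt0 ltr0n.
exists N => n nN V P hP hmu.
(* Splitting keeps the covered vertices and only removes edges, so multiplicities do not grow and a
   matching found here is one of [P]. *)
pose E c := split_edge (P c).
have hE c : small_cliques (E c) by have [tP P2 _] := hP c; exact: split_edge_small.
have sub c x y : E c x y -> col_edge P c x y.
  by have [tP P2 _] := hP c; exact: split_edge_block.
have [vt [e1 e2]] : exists vt, rmatch E [set: 'I_n] vt.
  apply: (hN _ nN _ _ hE) => [c|x y].
    have [tP P2 hv] := hP c; rewrite covered_split_edge //.
    rewrite -(ler_nat R) natrD !natrM.
    have k0 : (1000 * s)%N%:R != 0 :> R by rewrite pnatr_eq0.
    have : (1000 * s)%N%:R * ((3 - (1000 * s)%N%:R^-1) * n%:R) <= (1000 * s)%N%:R * #|cover (P c)|%:R :> R.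
      by rewrite ler_pM2l // ltr0n.
    rewrite mulrA mulrBr mulfV // natrM => h.
    lra.
  have h1 : (#|[set c | E c x y]| <= mult_pair P x y)%N.
    by apply/subset_leq_card/subsetP=> c; rewrite !in_set; exact: sub.
  have h2 := hmu x y; rewrite -(ler_nat R) natrD !natrM.
  rewrite -(ler_nat R) in h1; have h3 := le_trans h1 h2.
  have n0 : 0 <= n%:R :> R by rewrite ler0n.
  move: h3; rewrite -(ler_pM2l s0) => h3.
  have : n%:R <= delta * s%:R * n%:R :> R by rewrite ler_peMl.
  lra.
pose f (c : 'I_n) := (c, (vt c false, vt c true)).
exists [set f c | c in [set: 'I_n]]; split; last first.
  by rewrite card_imset ?cardsT ?card_ord // => c c' [].
split=> [_ /imsetP[c _ ->]|_ _ /imsetP[c _ ->] /imsetP[c' _ ->] cc'].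
  by apply/sub/e1; rewrite in_setT.
have {}cc' : c != c' by apply: contra cc' => /eqP->.
split=> //=; have hd i j : vt c i != vt c' j by apply: e2; rewrite ?in_setT.
rewrite -setI_eq0; apply/eqP/setP=> v; rewrite !inE.
by apply/negP=> /andP[/orP[]/eqP-> /orP[]]; rewrite (negbTE (hd _ _)).
Qed.
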